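(* All continuous semilattices with bottom elements (as objects) and all pseudo-invertible ambiguous representations (as arrows, an arrow from $S_1$ to $S_2$ being a pseudo-invertible ambiguous representation of $S_1$ in $S_2$), with the composition $R{;}Q$ and with the identity arrows $E_S=\{(x,y)\in S\times S\mid y\le x\}$, form a category $\mathcal{S}em\mathcal{PR}$. This category contains $\mathcal{S}em_0$ as a subcategory, via the embedding $I:\mathcal{S}em_0\to\mathcal{S}em\mathcal{PR}$ given by $IS=S$ on objects and $If=\{(x,y)\in S_1\times S_2\mid y\le f(x)\}$ for an arrow $f:S_1\to S_2$ of $\mathcal{S}em_0$.
   Context: Order-theoretic conventions. A subset $A$ of a poset is directed if for all $x,y\in A$ there is $z\in A$ with $x\le z$, $y\le z$; non-emptiness is not required, so the empty set is directed. A dcpo is a poset in which all directed subsets have suprema. One writes $x\ll y$ ($x$ is way below $y$) iff for every directed $D$ having a supremum, $y\le\sup D$ implies $x\le d$ for some $d\in D$ (so nothing is way below the least element). A continuous semilattice is a meet semilattice which is a dcpo and in which, for each $y$, the set $\{x\mid x\ll y\}$ is directed with supremum $y$. A subset of a dcpo is Scott closed if it is a lower set closed under suprema of its directed subsets; $\mathrm{Cl}(A)$ is the least Scott closed set containing $A$. A map between dcpos is Scott continuous iff it preserves suprema of directed sets. $\mathcal{S}em_0$ is the category of all continuous (meet) semilattices with zeros (bottom elements) and all Scott continuous zero-preserving meet-preserving maps. For continuous semilattices $S_1,S_2$ with zeros, an ambiguous representation of $S_1$ in $S_2$ is a binary relation $R\subset S_1\times S_2$ such that (a) if $(x,y)\in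 R$, $x\le x'$ in $S_1$ and $y'\le y$ in $S_2$, then $(x',y')\in R$; (b) for all $x\in S_1$ the set $xR=\{y\in S_2\mid (x,y)\in R\}$ is non-empty and closed under directed suprema in $S_2$. It is called pseudo-invertible if: whenever $(x,y)\in R$ and $y'\ll y$ in $S_2$, there is $x'\ll x$ in $S_1$ such that $(x',y')\in R$. For ambiguous representations $R\subset S_1\times S_2$, $Q\subset S_2\times S_3$, let $RQ=\{(x,z)\mid \exists y\in S_2:\ (x,y)\in R,\ (y,z)\in Q\}$ and $xRQ=\{z\mid (x,z)\in RQ\}$. The composition is $R{;}Q=\{(x,z)\in S_1\times S_3\mid z\in\mathrm{Cl}(xRQ)\}$, i.e. $(x,z)\in R{;}Q$ iff for all $z'\ll z$ there is $y\in S_2$ such that $(x,y)\in R$, $(y,z')\in Q$. *)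

(* Defs.v *)
From HB Require Import structures.
From mathcomp Require Import all_boot all_order.
From mathcomp Require Import boolp classical_sets.

Set Implicit Arguments.
Unset Strict Implicit.
Unset Printing Implicit Defensive.

Import Order.TTheory.

Local Open Scope classical_set_scope.
Local Open Scope order_scope.

Section Domain.
Context {d : Order.disp_t} {T : porderType d}.
Implicit Types (A D : set T) (x y s : T).

(* Non-emptiness is not required: the empty set is directed. *)
Definition directed A :=
  forall x y, A x -> A y -> exists z, [/\ A z, x <= z & y <= z].

Definition way_below x y :=
  forall D s, directed D -> supremums D s -> y <= s ->
    exists2 e, D e & x <= e.

Definition lower_set A := forall x y, A y -> x <= y -> A x.

Definition directed_sup_closed A :=
  forall D s, D `<=` A -> directed D -> supremums D s -> A s.

Definition scott_closed A := lower_set A /\ directed_sup_closed A.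

(* The intersection of all Scott closed supersets of A, which is Scott closed. *)
Definition Cl A : set T := smallest scott_closed A.

End Domain.

Definition is_dcpo d (T : porderType d) :=
  forall D : set T, directed D -> supremums D !=set0.

Definition scott_continuous d d' (T : porderType d) (T' : porderType d')
    (f : T -> T') :=
  forall D s, directed D -> supremums D s -> supremums (f @` D) (f s).

(* Continuous meet semilattices with bottom. *)
HB.mixin Record isContinuousSemilattice d T of Order.BMeetSemilattice d T := {
  directed_has_sup : is_dcpo T ;
  way_below_directed : forall y : T, directed [set x | way_below x y] ;
  way_below_sup : forall y : T, supremums [set x | way_below x y] y
}.

#[short(type="contSemilatticeType")]
HB.structure Definition ContSemilattice d :=
  { T of Order.BMeetSemilattice d T & isContinuousSemilattice d T }.

(* Composition is written in diagrammatic order: comp f g is f followed by g. *)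
Record category_data := CategoryData {
  Ob :> Type ;
  Hom : Ob -> Ob -> Type ;
  idm : forall a, Hom a a ;
  comp : forall a b c, Hom a b -> Hom b c -> Hom a c
}.
Arguments Hom {c} a b : rename.
Arguments idm {c} a : rename.
Arguments comp {c a b} {c0} f g : rename.

Definition is_category (C : category_data) :=
  [/\ forall (a b : C) (f : Hom a b), comp (idm a) f = f,
      forall (a b : C) (f : Hom a b), comp f (idm b) = f &
      forall (a b c e : C) (f : Hom a b) (g : Hom b c) (h : Hom c e),
        comp f (comp g h) = comp (comp f g) h].

Definition is_functor (C D : category_data) (F : C -> D)
    (Fm : forall a b : C, Hom a b -> Hom (F a) (F b)) :=
  (forall a : C, Fm a a (idm a) = idm (F a)) /\
  (forall (a b c : C) (f : Hom a b) (g : Hom b c),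
     Fm a c (comp f g) = comp (Fm a b f) (Fm b c g)).

(* A functor injective on objects and on arrows, i.e. one which identifies C
   with a subcategory of D. *)
Definition is_embedding (C D : category_data) (F : C -> D)
    (Fm : forall a b : C, Hom a b -> Hom (F a) (F b)) :=
  [/\ is_functor Fm, injective F & forall a b : C, injective (Fm a b)].

Definition sem0_arrow d (S1 S2 : contSemilatticeType d) (f : S1 -> S2) :=
  [/\ scott_continuous f, f \bot = \bot &
      {morph f : x y / Order.meet x y}].

Lemma sem0_arrow_id d (S : contSemilatticeType d) : sem0_arrow (@idfun S).
Proof. by split=> // D s _ ?; rewrite image_id. Qed.

Lemma scott_continuous_le d d' (T : porderType d) (T' : porderType d')
    (f : T -> T') : scott_continuous f -> {homo f : x y / x <= y}.
Proof.
move=> fc x y xy.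
have dxy : directed [set x; y].
  by move=> u v [] -> [] ->; exists y; split => //; right.
have sxy : supremums [set x; y] y.
  by split=> [u [] -> //|u]; apply; right.
by have [+ _] := fc _ _ dxy sxy; apply; exists x => //; left.
Qed.

Lemma sem0_arrow_comp d (S1 S2 S3 : contSemilatticeType d)
    (f : S1 -> S2) (g : S2 -> S3) :
  sem0_arrow f -> sem0_arrow g -> sem0_arrow (g \o f).
Proof.
move=> [fc f0 fI] [gc g0 gI]; split=> [D s dD sD||x y] /=.
- rewrite -image_comp; apply: gc; last exact: fc.
  move=> _ _ [u Du <-] [v Dv <-]; have [w [Dw uw vw]] := dD _ _ Du Dv.
  exists (f w); split; last exact: scott_continuous_le vw.
    by exists w.
  exact: scott_continuous_le uw.
- by rewrite f0.
- by rewrite fI gI.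
Qed.

Definition Sem0 (d : Order.disp_t) : category_data := {|
  Ob := contSemilatticeType d ;
  Hom := fun S1 S2 => {f : S1 -> S2 | sem0_arrow f} ;
  idm := fun S => exist _ idfun (sem0_arrow_id S) ;
  comp := fun _ _ _ f g =>
    exist _ (sval g \o sval f) (sem0_arrow_comp (svalP f) (svalP g))
|}.

Section AmbiguousRepresentations.
Context {d : Order.disp_t}.
Implicit Types S : contSemilatticeType d.

Definition ambiguous_representation S1 S2 (R : set (S1 * S2)) :=
  (forall x x' y y', R (x, y) -> x <= x' -> y' <= y -> R (x', y')) /\
  (forall x, xsection R x !=set0 /\ directed_sup_closed (xsection R x)).

Definition pseudo_invertible S1 S2 (R : set (S1 * S2)) :=
  forall x y y', R (x, y) -> way_below y' y ->
    exists2 x', way_below x' x & R (x', y').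

Definition pseudo_invertible_representation S1 S2 (R : set (S1 * S2)) :=
  ambiguous_representation R /\ pseudo_invertible R.

Definition rel_comp S1 S2 S3 (R : set (S1 * S2)) (Q : set (S2 * S3)) :
    set (S1 * S3) :=
  [set xz | exists2 y, R (xz.1, y) & Q (y, xz.2)].

Definition rep_comp S1 S2 S3 (R : set (S1 * S2)) (Q : set (S2 * S3)) :
    set (S1 * S3) :=
  [set xz | Cl (xsection (rel_comp R Q) xz.1) xz.2].

Definition rep_id S : set (S * S) := [set xy | xy.2 <= xy.1].
Arguments rep_id S : clear implicits.

Definition rep_of_map S1 S2 (f : S1 -> S2) : set (S1 * S2) :=
  [set xy | xy.2 <= f xy.1].

(* The closure of pseudo-invertible representations under identities and
   composition is taken as an argument: it is part of what has to be shown for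
   these data to make sense. *)
Definition SemPR
    (id_pi : forall S, pseudo_invertible_representation (rep_id S))
    (comp_pi : forall S1 S2 S3 (R : set (S1 * S2)) (Q : set (S2 * S3)),
       pseudo_invertible_representation R ->
       pseudo_invertible_representation Q ->
       pseudo_invertible_representation (rep_comp R Q)) : category_data := {|
  Ob := contSemilatticeType d ;
  Hom := fun S1 S2 =>
    {R : set (S1 * S2) | pseudo_invertible_representation R} ;
  idm := fun S => exist _ (rep_id S) (id_pi S) ;
  comp := fun S1 S2 S3 R Q =>
    exist _ (rep_comp (sval R) (sval Q))
      (comp_pi S1 S2 S3 (sval R) (sval Q) (svalP R) (svalP Q))
|}.

End AmbiguousRepresentations.
Arguments rep_id {d} S.

(* Main.v *)
(** In a continuous semilattice the Scott closure of a lower set [A] is the set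
    of all [z] such that every [z'] way below [z] lies in [A]. Hence [R ; Q] is
    described elementwise. Interpolation [z' << z'' << z] together with
    pseudo-invertibility removes the inner closure in an iterated composition:
    both bracketings consist of the pairs [(x, z)] such that every [z' << z] is
    reached from [x] by the plain relational product of the three relations. *)

Require Import Defs.
From HB Require Import structures.
From mathcomp Require Import all_boot all_order.
From mathcomp Require Import boolp classical_sets.

Set Implicit Arguments.
Unset Strict Implicit.
Unset Printing Implicit Defensive.

Import Order.TTheory.

Local Open Scope classical_set_scope.
Local Open Scope order_scope.

(** * The way-below relation, interpolation and Scott closure *)

Lemma way_below_le_trans d (T : porderType d) (x y z : T) :
  way_below x y -> y <= z -> way_below x z.
Proof. by move=> xy yz D s dD sD zs; apply: (xy D s dD sD (le_trans yz zs)). Qed.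

Lemma le_way_below_trans d (T : porderType d) (x y z : T) :
  x <= y -> way_below y z -> way_below x z.
Proof.
move=> xy yz D s dD sD zs; have [e De ye] := yz D s dD sD zs.
by exists e => //; apply: le_trans ye.
Qed.

Section ContinuousSemilattice.
Context {d : Order.disp_t} {S : contSemilatticeType d}.
Implicit Types x y z : S.

Lemma way_below_le x y : way_below x y -> x <= y.
Proof. by case: (way_below_sup y) => + _; apply. Qed.

Lemma le_way_belowP y z : y <= z <-> (forall x, way_below x y -> x <= z).
Proof.
split=> [yz x /way_below_le xy|H]; first exact: le_trans yz.
by case: (way_below_sup y) => _; apply.
Qed.

(** The elements lying two way-below steps under [z] form a directed set [D] with supremum [z];
    testing [x] against [D] yields the intermediate point. *)
Lemma way_below_interpolation x z :
  way_below x z -> exists2 y, way_below x y & way_below y z.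
Proof.
move=> xz; pose D := [set u | exists2 w, way_below u w & way_below w z].
have dD : directed D.
  move=> u1 u2 [w1 uw1 wz1] [w2 uw2 wz2].
  have [w [wz w1w w2w]] := way_below_directed z _ _ wz1 wz2.
  have [u [uw u1u u2u]] := way_below_directed w _ _
    (way_below_le_trans uw1 w1w) (way_below_le_trans uw2 w2w).
  by exists u; split=> //; exists w.
have sD : supremums D z.
  split=> [u [w uw wz]|u Du].
    exact: le_trans (way_below_le uw) (way_below_le wz).
  (* Approximating twice: an upper bound of [D] dominates every [v] way below [w], hence every [w]
     way below [z], hence [z]. *)
  apply/le_way_belowP => w wz; apply/le_way_belowP => v vw.
  by apply: Du; exists w.
have [u [w uw wz] xu] := xz D z dD sD (lexx z).
by exists w => //; apply: le_way_below_trans xu uw.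
Qed.

Lemma directed_sup_closed_way_below (A : set S) z :
  directed_sup_closed A -> (forall z', way_below z' z -> A z') -> A z.
Proof.
move=> cA H; apply: (cA [set z' | way_below z' z] z) => //.
- exact: way_below_directed.
- exact: way_below_sup.
Qed.

(** The right-hand side defines a Scott closed set that contains the lower set [A]; any other such
    set contains it, since [z] is the directed supremum of its approximants. *)
Lemma Cl_lower_setP (A : set S) z :
  lower_set A -> Cl A z <-> (forall z', way_below z' z -> A z').
Proof.
move=> lA; split=> [Az|Az B [[lB cB] AB]].
  apply: (Az [set z | forall z', way_below z' z -> A z']); split; last first.
    by move=> u Au z' /way_below_le z'u; apply: lA z'u.
  split=> [u v Av uv z' z'u|D s DA dD sD z' z's].
    exact/Av/(way_below_le_trans z'u).
  (* Using [z'] directly would only give [z' <= e] for some [e] in [D]; passing through [w] gives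
     that [z'] is way below [e]. *)
  have [w z'w ws] := way_below_interpolation z's.
  have [e De we] := ws D s dD sD (lexx s).
  exact: (DA e De _ (way_below_le_trans z'w we)).
by apply: directed_sup_closed_way_below => // z' /Az /AB.
Qed.

End ContinuousSemilattice.

(** * Pseudo-invertible representations and their composition *)

Section Composition.
Context {d : Order.disp_t}.
Implicit Types S : contSemilatticeType d.

(** Sections are closed under directed suprema, and [y] is the directed supremum of its
    approximants. This strips the closure in the unit laws. *)
Lemma ambiguous_way_below S1 S2 (R : set (S1 * S2)) x y :
  ambiguous_representation R ->
  (forall y', way_below y' y -> R (x, y')) -> R (x, y).
Proof.
move=> [_ /(_ x) [_ cR]] H; have : xsection R x y; last first.
  by rewrite xsectionE.
apply: directed_sup_closed_way_below => // y' /H.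
by rewrite xsectionE.
Qed.

Lemma rep_compP S1 S2 S3 (R : set (S1 * S2)) (Q : set (S2 * S3)) x z :
  ambiguous_representation Q ->
  rep_comp R Q (x, z) <->
  (forall z', way_below z' z -> exists2 y, R (x, y) & Q (y, z')).
Proof.
move=> [mQ _].
have lRQ : lower_set (xsection (rel_comp R Q) x).
  move=> u v; rewrite !xsectionE => -[y Rxy Qyv] uv.
  by exists y => //; apply: mQ Qyv _ uv.
apply: iff_trans (Cl_lower_setP _ lRQ) _.
by split=> H z' /H; rewrite xsectionE.
Qed.

Lemma rep_id_pseudo_invertible S : pseudo_invertible_representation (rep_id S).
Proof.
split; first split.
- by move=> x x' y y' /= yx xx' y'y; apply: le_trans y'y (le_trans yx xx').
- move=> x; split; first by exists x; rewrite xsectionE; exact: lexx.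
  move=> D s Dx _ [_ sD]; rewrite xsectionE; apply: sD => e /Dx.
  by rewrite xsectionE.
- move=> x y y' yx y'y; exists y'; last exact: lexx.
  exact: way_below_le_trans y'y yx.
Qed.

Lemma rep_of_map_pseudo_invertible S1 S2 (f : S1 -> S2) :
  scott_continuous f -> pseudo_invertible_representation (rep_of_map f).
Proof.
move=> cf; have mf := scott_continuous_le cf; split; first split.
- by move=> x x' y y' /= yx /mf xx' y'y; apply: le_trans y'y (le_trans yx xx').
- move=> x; split; first by exists (f x); rewrite xsectionE; exact: lexx.
  move=> D s Dx _ [_ sD]; rewrite xsectionE; apply: sD => e /Dx.
  by rewrite xsectionE.
- move=> x y y' /= yx y'y.
  (* By continuity [f x] is the directed supremum of the values [f x'] with [x'] way below [x], so
     [y'] lies below one of them. *)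
  have dx := @way_below_directed _ _ x.
  have dfx : directed (f @` [set x' | way_below x' x]).
    move=> _ _ [u ux <-] [v vx <-]; have [w [wx uw vw]] := dx _ _ ux vx.
    by exists (f w); split; [exists w | exact: mf | exact: mf].
  have [_ [x' x'x <-] y'fx'] := y'y _ _ dfx (cf _ _ dx (way_below_sup x)) yx.
  by exists x'.
Qed.

Lemma rep_comp_pseudo_invertible S1 S2 S3 (R : set (S1 * S2))
    (Q : set (S2 * S3)) :
  pseudo_invertible_representation R -> pseudo_invertible_representation Q ->
  pseudo_invertible_representation (rep_comp R Q).
Proof.
move=> [[mR sR] pR] [aQ pQ]; have [mQ sQ] := aQ.
split; first split.
- move=> x x' z z' /(rep_compP _ _ _ aQ) H xx' z'z; apply/rep_compP => // w wz'.
  have [y Rxy Qyw] := H w (way_below_le_trans wz' z'z).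
  by exists y => //; apply: mR Rxy xx' (lexx y).
- move=> x; split.
    have [[y]] := sR x; rewrite xsectionE => Rxy _.
    have [[z]] := sQ y; rewrite xsectionE => Qyz _.
    exists z; rewrite xsectionE; apply/rep_compP => // z' /way_below_le z'z.
    by exists y => //; apply: mQ Qyz _ z'z.
  move=> D s Dx dD sD; rewrite xsectionE; apply/rep_compP => // z' z's.
  have [w z'w ws] := way_below_interpolation z's.
  have [e De we] := ws D s dD sD (lexx s).
  have := Dx e De; rewrite xsectionE => /(rep_compP _ _ _ aQ); apply.
  exact: way_below_le_trans z'w we.
- move=> x z z' /(rep_compP _ _ _ aQ) H z'z.
  (* The point [w] is actually reached from [x] by the relational product, and [z'], way below [w],
     can then be pulled back through [Q] and next through [R]. *)
  have [w z'w wz] := way_below_interpolation z'z.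
  have [y Rxy Qyw] := H w wz.
  have [y' y'y Qy'z'] := pQ _ _ _ Qyw z'w.
  have [x' x'x Rx'y'] := pR _ _ _ Rxy y'y.
  exists x' => //; apply/rep_compP => // v /way_below_le vz'.
  by exists y' => //; apply: mQ Qy'z' _ vz'.
Qed.

Lemma rep_comp_idl S1 S2 (R : set (S1 * S2)) :
  ambiguous_representation R -> rep_comp (rep_id S1) R = R.
Proof.
move=> aR; have [mR _] := aR; apply/seteqP; split=> -[x z].
  move=> /(rep_compP _ _ _ aR) H; apply: ambiguous_way_below => // z' /H [y yx Ryz].
  exact: mR Ryz yx (lexx z').
move=> Rxz; apply/rep_compP => // z' /way_below_le z'z.
by exists x; [exact: lexx | exact: mR Rxz _ z'z].
Qed.

Lemma rep_comp_idr S1 S2 (R : set (S1 * S2)) :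
  ambiguous_representation R -> rep_comp R (rep_id S2) = R.
Proof.
move=> aR; have [mR _] := aR; have [aE _] := rep_id_pseudo_invertible S2.
apply/seteqP; split=> -[x z].
  move=> /(rep_compP _ _ _ aE) H; apply: ambiguous_way_below => // z' /H [y Rxy z'y].
  exact: mR Rxy (lexx x) z'y.
by move=> Rxz; apply/rep_compP => // z' /way_below_le z'z; exists z.
Qed.

Lemma rep_compA S1 S2 S3 S4 (R : set (S1 * S2)) (Q : set (S2 * S3))
    (P : set (S3 * S4)) :
  pseudo_invertible_representation Q -> pseudo_invertible_representation P ->
  rep_comp R (rep_comp Q P) = rep_comp (rep_comp R Q) P.
Proof.
move=> piQ piP; have [aQP _] := rep_comp_pseudo_invertible piQ piP.
case: piQ piP => [aQ pQ] [aP pP]; have [mQ _] := aQ; have [mP _] := aP.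
apply/seteqP; split=> -[x z].
  move=> /(rep_compP _ _ _ aQP) H; apply/rep_compP => // z' z'z.
  (* One approximation step is spent on the outer closure, at [v], and one on the inner closure, at
     [z']. *)
  have [v z'v vz] := way_below_interpolation z'z.
  have [y Rxy /(rep_compP _ _ _ aP) /(_ _ z'v) [w Qyw Pwz']] := H v vz.
  exists w => //; apply/rep_compP => // w' /way_below_le w'w.
  by exists y => //; apply: mQ Qyw _ w'w.
move=> /(rep_compP _ _ _ aP) H; apply/rep_compP => // z' z'z.
have [v z'v vz] := way_below_interpolation z'z.
have [w /(rep_compP _ _ _ aQ) RQxw Pwv] := H v vz.
(* Membership of [w] in the closure yields an intermediate [y] only for points way below [w];
   pseudo-invertibility of [P] supplies such a [w'] that still reaches [z']. *)
have [w' w'w Pw'z'] := pP _ _ _ Pwv z'v.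
have [y Rxy Qyw'] := RQxw _ w'w.
exists y => //; apply/rep_compP => // u /way_below_le uz'.
by exists w' => //; apply: mP Pw'z' _ uz'.
Qed.

Lemma rep_of_map_comp S1 S2 S3 (f : S1 -> S2) (g : S2 -> S3) :
  scott_continuous g ->
  rep_of_map (g \o f) = rep_comp (rep_of_map f) (rep_of_map g).
Proof.
move=> cg; have [ag _] := rep_of_map_pseudo_invertible cg.
apply/seteqP; split=> -[x z].
  move=> /= zgfx; apply/rep_compP => // z' /way_below_le z'z.
  (* The value [f x] is the greatest element related to [x], hence the best intermediate point. *)
  by exists (f x); [exact: lexx | exact: le_trans zgfx].
move=> /(rep_compP _ _ _ ag) H; apply/le_way_belowP => z' /H [y /= yfx z'gy].
exact: le_trans z'gy (scott_continuous_le cg yfx).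
Qed.

(** A map is recovered from its relation: [f x] is the greatest element of the section at [x]. *)
Lemma rep_of_map_inj S1 S2 : injective (@rep_of_map d S1 S2).
Proof.
move=> f g fg; apply/funext => x; apply/eqP; rewrite eq_le; apply/andP; split.
  have : rep_of_map f (x, f x) by exact: lexx.
  by rewrite fg.
have : rep_of_map g (x, g x) by exact: lexx.
by rewrite -fg.
Qed.

End Composition.

Theorem proposition3p0p3 (d : Order.disp_t) :
  exists (id_pi : forall S : contSemilatticeType d,
            pseudo_invertible_representation (rep_id S))
         (comp_pi : forall (S1 S2 S3 : contSemilatticeType d)
                           (R : set (S1 * S2)) (Q : set (S2 * S3)),
            pseudo_invertible_representation R ->
            pseudo_invertible_representation Q ->
            pseudo_invertible_representation (rep_comp R Q)),
    is_category (SemPR id_pi comp_pi) /\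
    is_category (Sem0 d) /\
    exists I_pi : forall (S1 S2 : contSemilatticeType d)
                         (f : {f : S1 -> S2 | sem0_arrow f}),
             pseudo_invertible_representation (rep_of_map (sval f)),
      @is_embedding (Sem0 d) (SemPR id_pi comp_pi)
        (fun S => S)
        (fun S1 S2 f => exist _ (rep_of_map (sval f)) (I_pi S1 S2 f)).
Proof.
exists (@rep_id_pseudo_invertible d), (@rep_comp_pseudo_invertible d).
split; last split.
- split=> [S1 S2 [R [aR pR]]|S1 S2 [R [aR pR]]|S1 S2 S3 S4 [R piR] [Q piQ] [P piP]];
    apply: eq_exist => /=.
  + exact: rep_comp_idl.
  + exact: rep_comp_idr.
  + exact: rep_compA.
(* The laws hold definitionally for the underlying functions; the attached proofs agree by proof
   irrelevance. *)
- by split=> [S1 S2 [f af]|S1 S2 [f af]|S1 S2 S3 S4 [f af] [g ag] [h ah]];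
    apply: eq_exist.
have I_pi (S1 S2 : contSemilatticeType d) (f : {f : S1 -> S2 | sem0_arrow f}) :
    pseudo_invertible_representation (rep_of_map (sval f)).
  by apply: rep_of_map_pseudo_invertible; case: (svalP f).
exists I_pi; split.
- split=> [S|S1 S2 S3 f g]; apply: eq_exist => //=.
  by apply: rep_of_map_comp; case: (svalP g).
- by move=> S1 S2.
- move=> S1 S2 [f af] [g ag] /(congr1 sval) /= /rep_of_map_inj fg.
  exact: eq_exist.
Qed.
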